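(* For any Laurent partition $\rho$ and any positive integer $n$, \[ \operatorname{Hilb}\,\Delta'_{m_\rho}=\sum_{\substack{\alpha\in\mathbb{Z}^{n-1}\\ \operatorname{sort}(\alpha)=\rho}}\widetilde{\operatorname{Hilb}}_{\alpha} \] as linear maps $\Lambda^{(n)}\to\mathbb{Q}(q,t)$, where the left side is the map $f\mapsto\langle\Delta'_{m_\rho}f,\,p_{1^n}\rangle$.
   Context: $\Lambda^{(n)}$ is the space of symmetric functions of degree $n$ over $\mathbb{Q}(q,t)$ with the Hall inner product $\langle\cdot,\cdot\rangle$; $p_{1^n}=p_1^n$. The modified Macdonald polynomials $\widetilde H_\mu$, $\mu\vdash n$, form a basis. Young diagrams are in French notation; for a cell $c$, $a'(c)$ and $\ell'(c)$ are the numbers of cells strictly to the left of and strictly below $c$. Set $T_\mu=\prod_{c\in\mu}q^{a'(c)}t^{\ell'(c)}$ and $B_\mu=\sum_{c\in\mu}q^{a'(c)}t^{\ell'(c)}$, so $B_\mu-1$ is the sum of the $n-1$ monomials $q^{a'(c)}t^{\ell'(c)}$ over cells $c\neq(0,0)$. A Laurent partition is a finite weakly decreasing sequence of nonzero integers; $m_\rho$ is the monomial symmetric Laurent polynomial, the sum of all distinct monomials whose nonzero exponents, sorted weakly decreasingly, equal $\rho$. For a symmetric Laurent polynomial $f$ and a sum $S=s_1+\dots+s_k$ of monic monomials, $f[S]$ is $f$ evaluated at $x_1=s_1,\dots,x_k=s_k$ (keeping only monomials in $x_1,\dots,x_k$). The operator $\Delta'_f$ on $\Lambda^{(n)}$ is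 defined by $\Delta'_f\widetilde H_\mu=f[B_\mu-1]\widetilde H_\mu$. For $\alpha\in\mathbb{Z}^{n-1}$, $\operatorname{sort}(\alpha)$ is obtained by deleting the zero entries and sorting the rest weakly decreasingly. The skew Pieri coefficients $c_{\mu,\nu}$ are defined by $e_1^\perp\widetilde H_\mu=\sum_{\nu\to\mu}c_{\mu,\nu}\widetilde H_\nu$, where $e_1^\perp$ is the adjoint of multiplication by $e_1$ and the sum is over $\nu$ obtained from $\mu$ by removing one cell. For $\alpha\in\mathbb{Z}^{n-1}$, $\mu\vdash n$, define recursively $F^{\alpha}_\mu=\sum_{\nu\to\mu}c_{\mu,\nu}(T_\mu/T_\nu)^{\alpha_1}F^{(\alpha_2,\dots,\alpha_{n-1})}_\nu$ with $F^{()}_{(1)}=1$, and let $\widetilde{\operatorname{Hilb}}_\alpha:\Lambda^{(n)}\to\mathbb{Q}(q,t)$ be the linear map $\widetilde H_\mu\mapsto F^\alpha_\mu$. *)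

(* Defs.v *)
From HB Require Import structures.
From mathcomp Require Import all_boot all_order all_algebra.
From mathcomp Require Import finmap.
From mathcomp.multinomials Require Import monalg.

Set Implicit Arguments.
Unset Strict Implicit.
Unset Printing Implicit Defensive.

Import Order.TTheory GRing.Theory Num.Theory.
Local Open Scope ring_scope.

(** * Partitions *)

Definition is_part (mu : seq nat) : bool := sorted geq mu && (0%N \notin mu).

Definition parts (n : nat) : seq (seq nat) :=
  undup [seq mu <- [seq [seq x <- map val (val s) | (0 < x)%N]
                      | s : n.-tuple 'I_n.+1]
           | is_part mu && (sumn mu == n)].

Lemma parts_uniq n : uniq (parts n).
Proof. exact: undup_uniq. Qed.

Lemma size_le_sumn (mu : seq nat) : 0%N \notin mu -> (size mu <= sumn mu)%N.
Proof.
elim: mu => //= x mu IH; rewrite inE negb_or => /andP[x0 /IH le].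
by rewrite -add1n leq_add // lt0n eq_sym.
Qed.

Lemma mem_le_sumn (mu : seq nat) x : x \in mu -> (x <= sumn mu)%N.
Proof.
elim: mu => //= y mu IH; rewrite inE => /orP[/eqP->|/IH le].
  exact: leq_addr.
exact: leq_trans le (leq_addl _ _).
Qed.

Lemma mem_parts n mu : (mu \in parts n) = is_part mu && (sumn mu == n).
Proof.
rewrite mem_undup mem_filter; apply/andb_idr => /andP[pmu /eqP smu].
have n0 : 0%N \notin mu by case/andP: pmu.
have szs :
    size [seq inord x : 'I_n.+1 | x <- mu ++ nseq (n - size mu) 0%N] == n.
  by rewrite size_map size_cat size_nseq subnKC // -smu size_le_sumn.
apply/imageP; exists (@Tuple n 'I_n.+1 _ szs) => //=.
rewrite -map_comp map_cat filter_cat -[LHS]cats0; congr (_ ++ _).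
  rewrite (eq_in_map _ id mu).1 ?map_id => [|x /mem_le_sumn].
    apply/esym/all_filterP/allP => x xmu; rewrite lt0n.
    by apply: contraNneq n0 => <-.
  by rewrite smu => le /=; rewrite inordK.
by rewrite map_nseq /= inordK //; elim: (n - size mu)%N.
Qed.

(* In French notation a cell is the pair (column, row), counted from 0, with
   row i of length nth 0 mu i; hence a'(c) = c.1 and l'(c) = c.2. *)
Definition cells (mu : seq nat) : seq (nat * nat) :=
  [seq (j, i) | i <- iota 0 (size mu), j <- iota 0 (nth 0%N mu i)].

(* nu -> mu *)
Definition removes_cell (nu mu : seq nat) : bool :=
  has (fun c => perm_eq (cells mu) (c :: cells nu)) (cells mu).

Definition conj_part (mu : seq nat) : seq nat :=
  [seq count (fun r => j < r)%N mu | j <- iota 0 (head 0%N mu)].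

(* Dominance order la >= mu, for partitions of the same integer. *)
Definition dominates (la mu : seq nat) : bool :=
  all (fun k => sumn (take k mu) <= sumn (take k la))%N
    (iota 0 (size la + size mu).+1).

(** * Laurent partitions *)

Definition laurent_partition (rho : seq int) : bool :=
  sorted >=%R rho && (0 \notin rho).

Definition sort_nonzero (alpha : seq int) : seq int :=
  sort >=%R [seq a <- alpha | a != 0].

(* The finitely many alpha in Z^k with sort(alpha) = rho. *)
Definition arrangements (k : nat) (rho : seq int) : seq (seq int) :=
  [seq alpha <- permutations (rho ++ nseq (k - size rho) 0)
     | (size alpha == k) && (sort_nonzero alpha == rho)].

Lemma arrangements_uniq k rho : uniq (arrangements k rho).
Proof. exact/filter_uniq/permutations_uniq. Qed.

Lemma mem_arrangements k rho alpha :
  (alpha \in arrangements k rho) =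
  (size alpha == k) && (sort_nonzero alpha == rho).
Proof.
rewrite mem_filter; apply/andb_idr => /andP[/eqP sk /eqP srt].
rewrite mem_permutations -srt -sk.
have eq0 : [seq a <- alpha | ~~ (a != 0)]
    = nseq (size alpha - size (sort_nonzero alpha)) 0.
  rewrite size_sort size_filter -(count_predC (fun a => a != 0) alpha) addKn.
  rewrite -size_filter; apply/all_pred1P; rewrite all_filter.
  by apply/allP => a _; apply/implyP; rewrite /= negbK.
have /permEl pF := perm_filterC (fun a => a != 0) alpha.
rewrite -eq0 perm_sym; apply: perm_trans pF.
by rewrite perm_cat2r perm_sort.
Qed.

(** * Symmetric functions *)

Section SymmetricFunctions.

Variables (K : fieldType) (q t : K).

Definition cell_weight (c : nat * nat) : K := q ^+ c.1 * t ^+ c.2.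

Definition T_mu (mu : seq nat) : K := \prod_(c <- cells mu) cell_weight c.

(* The list of the n - 1 monic monomials s_1, ..., s_{n-1} of B_mu - 1. *)
Definition alphabet_B1 (mu : seq nat) : seq K :=
  [seq cell_weight c | c <- cells mu & c != (0%N, 0%N)].

(* The ring of symmetric functions, presented as the polynomial ring over
   K in the power sums p_1, p_2, ...; the variable of index i is
   p_{i+1}. *)
Local Notation Lambda := {malg K[{cmonom nat}]}.

(* p_k, for k >= 1 *)
Definition psum (k : nat) : Lambda := << ucm k.-1 >>.

(* Monomial of p_la = p_{la_1} p_{la_2} ... *)
Definition pmon (la : seq nat) : {cmonom nat} :=
  \big[mmul/mone]_(k <- la) ucm k.-1.

(* z_la = prod_k k^{m_k} m_k!, where m_k is the exponent of p_k. *)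
Definition zee (m : {cmonom nat}) : K :=
  \prod_(i <- finsupp m) ((i.+1 ^ m i)%N * (m i)`!)%N%:R.

(* The Hall inner product: <p_la, p_mu> = z_la if la = mu, and 0 otherwise. *)
Definition hall (f g : Lambda) : K :=
  \sum_(m <- msupp f) f@_m * g@_m * zee m.

Definition pdegree (m : {cmonom nat}) : nat :=
  \sum_(i <- finsupp m) (i.+1 * m i)%N.

Definition LambdaN (n : nat) : {pred Lambda} :=
  fun f => all (fun m => pdegree m == n) (msupp f).

(* h_n = sum over la |- n of p_la / z_la *)
Definition complete (n : nat) : Lambda :=
  \sum_(la <- parts n) << (zee (pmon la))^-1 *g pmon la >>.

(* Jacobi-Trudi: s_la = det (h_{la_i - i + j}), with h_k = 0 for k < 0. *)
Definition schur (la : seq nat) : Lambda :=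
  \det (\matrix_(i < size la, j < size la)
    if (i <= nth 0 la i + j)%N then complete (nth 0 la i + j - i)%N else 0).

(* The plethysm f |-> f[X (1 - u)], i.e. the algebra morphism with
   p_k |-> (1 - u^k) p_k. *)
Definition pleth1B (u : K) (f : Lambda) : Lambda :=
  \sum_(m <- msupp f)
    << f@_m * \prod_(i <- finsupp m) (1 - u ^+ i.+1) ^+ m i *g m >>.

(* e_1^perp is d/dp_1; hall_e1perp below shows that it is the adjoint of
   multiplication by e_1 = p_1. *)
Definition e1perp (f : Lambda) : Lambda :=
  \sum_(m <- msupp f) << f@_m * (m 0%N)%:R *g divcm m (ucm 0%N) >>.

Lemma hallEw (d : {fset {cmonom nat}}) (f g : Lambda) :
  (msupp f `<=` d)%fset -> hall f g = \sum_(m <- d) f@_m * g@_m * zee m.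
Proof.
move=> le; rewrite /hall (big_fset_incl _ le) // => m _ /mcoeff_outdom ->.
by rewrite !mul0r.
Qed.

Lemma hallC (f g : Lambda) : hall f g = hall g f.
Proof.
rewrite (hallEw _ (fsubsetUl _ (msupp g))) (hallEw _ (fsubsetUr (msupp f) _)).
by apply: eq_bigr => m _; rewrite (mulrC f@_m).
Qed.

Lemma hallDl (f1 f2 g : Lambda) : hall (f1 + f2) g = hall f1 g + hall f2 g.
Proof.
pose d := (msupp f1 `|` msupp f2)%fset.
rewrite (@hallEw d f1) ?fsubsetUl // (@hallEw d f2) ?fsubsetUr //.
rewrite (@hallEw d (f1 + f2)) ?msuppD_le // -big_split /=.
by apply: eq_bigr => m _; rewrite mcoeffD !mulrDl.
Qed.

Lemma hall0l (g : Lambda) : hall 0 g = 0.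
Proof. by rewrite /hall msupp0 big_seq_fset0. Qed.

Lemma hall_suml (I : Type) (r : seq I) (F : I -> Lambda) g :
  hall (\sum_(i <- r) F i) g = \sum_(i <- r) hall (F i) g.
Proof. by apply: (big_morph (hall^~ g)) => [f1 f2|]; rewrite ?hallDl ?hall0l. Qed.

Lemma hall_sumr (I : Type) (r : seq I) (F : I -> Lambda) f :
  hall f (\sum_(i <- r) F i) = \sum_(i <- r) hall f (F i).
Proof. by rewrite hallC hall_suml; apply: eq_bigr => i _; rewrite hallC. Qed.

Lemma hallUU a b (m k : {cmonom nat}) :
  hall << a *g m >> << b *g k >> = (a * b * zee m) *+ (m == k).
Proof.
rewrite (hallEw _ (@msuppU_le _ K m a)) big_seq_fset1.
transitivity (a * (b *+ (k == m)) * zee m).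
  apply: (f_equal2 (fun x y => x * y * zee m)).
    exact: mcoeffUU.
  exact: mcoeffU.
by rewrite eq_sym; case: (m == k); rewrite ?mulr1n // !mulr0n mulr0 mul0r.
Qed.

Lemma zeeEw (d : {fset nat}) (m : {cmonom nat}) : (finsupp m `<=` d)%fset ->
  zee m = \prod_(i <- d) ((i.+1 ^ m i)%N * (m i)`!)%N%:R.
Proof.
move=> le; rewrite /zee (big_fset_incl _ le) // => i _.
by rewrite -cmE_neq0 negbK => /eqP ->.
Qed.

Lemma zeeMU0 (m : {cmonom nat}) :
  zee (mmul (ucm 0%N) m) = (m 0%N).+1%:R * zee m.
Proof.
pose d := (0%N |` finsupp m)%fset.
have d0 : 0%N \in d by rewrite in_fset1U eqxx.
rewrite (@zeeEw d) ?mdomD ?mdomU ?fsubset_refl // (@zeeEw d m) ?fsubsetUr //.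
rewrite (big_fsetD1 _ d0) [in RHS](big_fsetD1 _ d0) /=.
have -> : mmul (ucm 0%N) m 0%N = (m 0%N).+1 by rewrite cmM cmU add1n.
rewrite !exp1n !mul1n factS natrM -[LHS]mulrA.
congr (_ * (_ * _)).
apply: eq_big_seq => i; rewrite in_fsetD1 => /andP[i0 _].
by rewrite cmM cmU eq_sym (negbTE i0).
Qed.

Lemma hall_e1perpU a b (m k : {cmonom nat}) :
  hall << a * (m 0%N)%:R *g divcm m (ucm 0%N) >> << b *g k >> =
  hall << a *g m >> (psum 1 * << b *g k >>).
Proof.
have -> : psum 1 * << b *g k >> = << b *g mmul (ucm 0%N) k >>.
  by apply: etrans (fgmulUU 1 b (ucm 0%N) k) _; rewrite (mul1r b).
apply: etrans (hallUU _ _ _ _) (esym (etrans (hallUU _ _ _ _) _)).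
have [->|ne] := eqVneq m (mmul (ucm 0%N) k).
  have -> : divcm (mmul (ucm 0%N) k) (ucm 0%N) = k.
    by apply/eqP/cmP => i; rewrite divcmE cmM ucmE addKn.
  have -> : mmul (ucm 0%N) k 0%N = (k 0%N).+1 by rewrite cmM cmU add1n.
  by rewrite eqxx zeeMU0 !mulr1n mulrA (mulrAC a b).
have [e|ne2] := eqVneq (divcm m (ucm 0%N)) k; last by rewrite !mulr0n.
case: (posnP (m 0%N)) => [->|m0]; first by rewrite mulr0 !mul0r mul0rn.
case/eqP: ne; apply/eqP/cmP => i; rewrite cmM -e divcmE cmU.
by case: eqP => [<-|_]; rewrite ?subnKC ?add0n ?subn0.
Qed.

Lemma hall_e1perp (f g : Lambda) : hall (e1perp f) g = hall f (psum 1 * g).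
Proof.
transitivity (\sum_(m <- msupp f) hall << f@_m *g m >> (psum 1 * g)); last first.
  by rewrite -hall_suml -monalgE.
rewrite hall_suml; apply: eq_bigr => m _.
transitivity (\sum_(k <- msupp g)
    hall << f@_m *g m >> (psum 1 * << g@_k *g k >>)).
  apply: etrans (f_equal (hall _) (monalgE g)) _.
  apply: etrans (hall_sumr _ _ _) _.
  apply: eq_bigr => k _.
  exact: (hall_e1perpU f@_m g@_k m k).
apply: etrans (esym (hall_sumr _ _ _)) _.
apply: (f_equal (hall _)).
apply: etrans (esym (mulr_sumr _ _ _ _)) _.
apply: (f_equal (fun h => psum 1 * h)).
exact: esym (monalgE g).
Qed.

(** * Modified Macdonald polynomials *)

(* f is in the span of the Schur functions s_la with la >= mu, |la| = |mu|. *)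
Definition in_schur_span (mu : seq nat) (f : Lambda) : Prop :=
  exists a : seq nat -> K,
    f = \sum_(la <- parts (sumn mu) | dominates la mu) a la *: schur la.

(* H is the family of modified Macdonald polynomials: the basis of Lambda
   characterized by the triangularity and normalization conditions
     H_mu[X(1-q)] in span {s_la : la >= mu},
     H_mu[X(1-t)] in span {s_la : la >= mu'},
     <H_mu, s_(n)> = 1. *)
Record modified_macdonald (H : seq nat -> Lambda) : Prop := ModifiedMacdonald {
  macdonald_deg : forall mu, is_part mu -> H mu \in LambdaN (sumn mu);
  macdonald_span : forall n f, f \in LambdaN n ->
    exists a : seq nat -> K, f = \sum_(mu <- parts n) a mu *: H mu;
  macdonald_free : forall n (a : seq nat -> K),
    \sum_(mu <- parts n) a mu *: H mu = 0 ->
    forall mu, mu \in parts n -> a mu = 0;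
  macdonald_triq : forall mu, is_part mu ->
    in_schur_span mu (pleth1B q (H mu));
  macdonald_trit : forall mu, is_part mu ->
    in_schur_span (conj_part mu) (pleth1B t (H mu));
  macdonald_norm : forall mu, is_part mu -> hall (H mu) (schur [:: sumn mu]) = 1
}.

(* c is a family of skew Pieri coefficients: its values c_{mu,nu} with nu -> mu
   are determined by this identity, as the H_nu are linearly independent. *)
Definition skew_pieri (H : seq nat -> Lambda)
    (c : seq nat -> seq nat -> K) : Prop :=
  forall mu, is_part mu -> (0 < sumn mu)%N ->
    e1perp (H mu) =
    \sum_(nu <- parts (sumn mu).-1 | removes_cell nu mu) c mu nu *: H nu.

(* F^alpha_mu, for mu a partition of size alpha + 1. *)
Fixpoint Fcoef (c : seq nat -> seq nat -> K) (alpha : seq int)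
    (mu : seq nat) : K :=
  if alpha is a :: alpha' then
    \sum_(nu <- parts (sumn mu).-1 | removes_cell nu mu)
      c mu nu * (T_mu mu / T_mu nu) ^ a * Fcoef c alpha' nu
  else (mu == [:: 1%N])%:R.

(* m_rho evaluated at x_1 = s_1, ..., x_k = s_k: the monomials of m_rho in
   x_1, ..., x_k are the x^beta with beta in Z^k and sort(beta) = rho. *)
Definition mlaurent (rho : seq int) (s : seq K) : K :=
  \sum_(beta <- arrangements (size s) rho)
    \prod_(i < size s) nth 0 s i ^ nth 0 beta i.

(* For D linear: D restricts to Delta'_f on Lambda^(n); the symmetric Laurent polynomial f
   is given through its evaluations on finite alphabets. *)
Definition is_Delta' (H : seq nat -> Lambda) (n : nat) (f : seq K -> K)
    (D : Lambda -> Lambda) : Prop :=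
  forall mu, mu \in parts n -> D (H mu) = f (alphabet_B1 mu) *: H mu.

(* For L linear: L restricts to the linear form Hilb~_alpha on Lambda^(n). *)
Definition is_Hilb_alpha (H : seq nat -> Lambda)
    (c : seq nat -> seq nat -> K) (n : nat) (alpha : seq int)
    (L : Lambda -> K) : Prop :=
  forall mu, mu \in parts n -> L (H mu) = Fcoef c alpha mu.

End SymmetricFunctions.

Notation Lambda K := {malg K[{cmonom nat}]}.

(** * The field Q(q,t) *)

(* The fraction field of Q[q][t], at which K is to be instantiated. *)
Notation Qqt := {fraction {poly {poly rat}}}.
Definition q_ : Qqt := FracField.tofrac ('X%:P).
Definition t_ : Qqt := FracField.tofrac 'X.

(* Main.v *)
(* Both sides are linear, so take f = H_mu. Unfolding F^alpha_mu gives a sum over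
   the chains from mu down to (1) of a product of skew Pieri coefficients times
   prod_i w_i^alpha_i, where w_i = T_mu / T_nu is the weight of the i-th removed
   cell. Every chain removes all the cells of mu but the origin, so the sum over
   alpha of prod_i w_i^alpha_i is m_rho[B_mu - 1], whatever the chain. The
   remaining sum of products of Pieri coefficients is <H_mu, p_1^n>, because
   e_1^perp is adjoint to multiplication by p_1 and <H_(1), p_1> = 1. *)
Require Import Defs.
From HB Require Import structures.
From mathcomp Require Import all_boot all_order all_algebra.
From mathcomp Require Import finmap.
From mathcomp.multinomials Require Import monalg.

Set Implicit Arguments.
Unset Strict Implicit.
Unset Printing Implicit Defensive.

Import Order.TTheory GRing.Theory Num.Theory.
Local Open Scope ring_scope.

(** * Rearrangements of a Laurent partition padded with zeros *)

(** Permuting [rho] padded with zeros keeps its nonzero entries, and [rho] is already sorted, so the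
    filter discards nothing. The induction on chains can then treat zeros like any other
    exponent. *)
Lemma arrangements_permutations k rho :
  laurent_partition rho -> (size rho <= k)%N ->
  arrangements k rho = permutations (rho ++ nseq (k - size rho) 0).
Proof.
case/andP=> srt n0 le; apply/all_filterP/allP => al.
rewrite mem_permutations => pal; apply/andP; split.
  by rewrite (perm_size pal) size_cat size_nseq subnKC.
apply/eqP; rewrite /sort_nonzero.
have tr : transitive (>=%R : rel int) by move=> y x z /= xy yz; apply: le_trans yz xy.
have tot : total (>=%R : rel int) by move=> x y; exact: le_total.
have asy : antisymmetric (>=%R : rel int) by move=> x y /= h; apply: le_anti; rewrite andbC.
rewrite -[RHS](sorted_sort tr srt); apply/(perm_sortP tot tr asy).
apply: (perm_trans (perm_filter _ pal)).
rewrite filter_cat filter_nseq eqxx /= cats0 (all_filterP _) //.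
by apply/allP => x xr; apply: contraNneq n0 => <-.
Qed.

Lemma arrangements_small k rho : (k < size rho)%N -> arrangements k rho = [::].
Proof.
move=> lt; apply/eqP; rewrite -size_eq0 -leqn0 leqNgt -has_predT; apply/hasPn => al.
rewrite mem_arrangements => /andP[/eqP sal /eqP srt].
by move: lt; rewrite -srt size_sort size_filter -sal ltnNge count_size.
Qed.

(** Groups the distinct permutations by first entry; [undup] keeps repeated entries of [s] from
    counting a group twice. *)
Lemma perm_permutations_rem (T : eqType) (s : seq T) : (0 < size s)%N ->
  perm_eq (permutations s)
    [seq a :: p | a <- undup s, p <- permutations (rem a s)].
Proof.
move=> s0; apply: uniq_perm.
- exact: permutations_uniq.
- apply: allpairs_uniq_dep; first exact: undup_uniq.
    by move=> a _; apply: permutations_uniq.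
  by move=> [a p] [b r] _ _ /= [-> ->].
move=> al; rewrite mem_permutations; apply/idP/allpairsPdep.
  case: al => [/perm_size e|a p pe]; first by rewrite -e in s0.
  have ia : a \in s by rewrite -(perm_mem pe) mem_head.
  exists a, p; split; rewrite ?mem_undup // mem_permutations.
  by rewrite -(perm_cons a) (perm_trans pe) // perm_to_rem.
case=> a [p [ia ip ->]].
rewrite mem_undup in ia; rewrite mem_permutations in ip.
by rewrite (perm_trans _ (_ : perm_eq (a :: rem a s) s)) ?perm_cons // perm_sym perm_to_rem.
Qed.

(** * Monomial sums over a multiset of exponents *)

Section MonomialSum.

Variable K : fieldType.

(* m_rho evaluated at x, when e is rho padded with zeros to the length of x. *)
Definition monomial_sum (e : seq int) (x : seq K) : K :=
  \sum_(beta <- permutations e) \prod_(i < size x) nth 0 x i ^ nth 0 beta i.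

Lemma monomial_sum_cons (e : seq int) (w : K) (x : seq K) : (0 < size e)%N ->
  monomial_sum e (w :: x) =
  \sum_(a <- undup e) w ^ a * monomial_sum (rem a e) x.
Proof.
move=> e0; rewrite /monomial_sum (perm_big _ (perm_permutations_rem e0)) /=.
rewrite big_allpairs_dep; apply: eq_bigr => a _.
by rewrite big_distrr; apply: eq_bigr => p _; rewrite big_ord_recl.
Qed.

(** A permutation [I] of the indices that carries [y] to [x] is absorbed by reindexing the exponents
    along [I]. Equal lengths make each reindexed list a permutation of [e] again. *)
Lemma monomial_sum_perm (e : seq int) (x y : seq K) :
  size e = size y -> perm_eq x y -> monomial_sum e x = monomial_sum e y.
Proof.
move=> sey pxy; have [I pI xE] := perm_iotaP 0 pxy.
have szI : size I = size y by rewrite (perm_size pI) size_iota.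
pose g (be : seq int) := [seq nth 0 be i | i <- I].
have pg be : be \in permutations e -> g be \in permutations e.
  rewrite !mem_permutations => pb; apply: perm_trans (pb).
  by apply/(perm_iotaP 0); exists I; rewrite ?(perm_size pb) ?sey.
have gi : {in permutations e &, injective g}.
  move=> b1 b2; rewrite !mem_permutations => /perm_size s1 /perm_size s2 /eq_in_map eg.
  apply: (@eq_from_nth _ 0) => [|i]; rewrite s1 // sey => lt.
  by apply: eg; rewrite (perm_mem pI) mem_iota.
have pm : perm_eq (map g (permutations e)) (permutations e).
  have um : uniq (map g (permutations e)) by rewrite map_inj_in_uniq ?permutations_uniq.
  apply: uniq_perm => //; first exact: permutations_uniq.
  (* An injective self-map of a finite set is onto. *)
  have := @uniq_min_size _ (map g (permutations e)) (permutations e) um.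
  case=> //; last by rewrite size_map.
  by move=> _ /mapP[b ib ->]; apply: pg.
rewrite /monomial_sum -(perm_big _ pm) /= big_map; apply: eq_bigr => be _.
have -> : \prod_(i < size y) nth 0 y i ^ nth 0 be i
        = \prod_(i <- I) nth 0 y i ^ nth 0 be i :> K.
  by rewrite (perm_big _ pI) -[in iota _ _](subn0 (size y)) big_mkord.
rewrite (big_nth 0%N) big_mkord xE size_map; apply: eq_bigr => i _.
by rewrite !(nth_map 0%N).
Qed.

End MonomialSum.

(** * Cells and the alphabet of B_mu - 1 *)

Lemma cells_uniq mu : uniq (cells mu).
Proof.
apply: allpairs_uniq_dep; first exact: iota_uniq.
  by move=> i _; apply: iota_uniq.
by move=> [i j] [i' j'] _ _ /= [-> ->].
Qed.

Lemma size_cells mu : size (cells mu) = sumn mu.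
Proof.
rewrite size_allpairs_dep; congr sumn.
rewrite -[RHS](mkseq_nth 0%N); apply: eq_map => i; exact: size_iota.
Qed.

Lemma cells00 mu : is_part mu -> (0 < sumn mu)%N -> (0%N, 0%N) \in cells mu.
Proof.
case/andP=> _; case: mu => // x mu; rewrite inE eq_sym negb_or -lt0n => /andP[x0 _] _.
by apply/allpairsPdep; exists 0%N, 0%N; rewrite !mem_iota.
Qed.

Section Macdonald.

Variables (K : fieldType) (q t : K).
Hypotheses (q0 : q != 0) (t0 : t != 0).

Lemma cell_weight_neq0 c : cell_weight q t c != 0.
Proof. by rewrite mulf_neq0 ?expf_neq0. Qed.

Lemma T_mu_neq0 mu : T_mu q t mu != 0.
Proof. by rewrite /T_mu prodf_seq_neq0; apply/allP => c _; apply: cell_weight_neq0. Qed.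

Lemma size_alphabet_B1 mu : is_part mu -> (0 < sumn mu)%N ->
  size (alphabet_B1 q t mu) = (sumn mu).-1.
Proof.
move=> pmu mu0; rewrite size_map size_filter -size_cells.
rewrite -(count_predC (pred1 (0%N, 0%N))) (count_uniq_mem _ (cells_uniq mu)).
by rewrite cells00 //= add1n.
Qed.

Lemma removes_cell_alphabet nu mu : is_part nu -> (0 < sumn nu)%N ->
  removes_cell nu mu ->
  perm_eq (alphabet_B1 q t mu) (T_mu q t mu / T_mu q t nu :: alphabet_B1 q t nu).
Proof.
move=> pnu nu0 /hasP[c _ pc].
have -> : T_mu q t mu / T_mu q t nu = cell_weight q t c.
  by rewrite /T_mu (perm_big _ pc) big_cons mulfK // T_mu_neq0.
(* The nonempty [nu] already contains the origin, and [mu] has no repeated cell. *)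
have c0 : c != (0%N, 0%N).
  apply: contraTneq (cells_uniq mu) => ce.
  by rewrite (perm_uniq pc) /= ce cells00.
rewrite (_ : _ :: _ = [seq cell_weight q t d | d <- c :: cells nu & d != (0%N, 0%N)]).
  by apply/perm_map/perm_filter.
by rewrite /= c0.
Qed.

(** * Pairing with powers of p_1 and summing over chains *)

Lemma hallZl (a : K) (f g : Lambda K) : hall (a *: f) g = a * hall f g.
Proof.
rewrite (hallEw _ (msuppZ_le a f)) /hall big_distrr /=.
by apply: eq_bigr => m _; rewrite mcoeffZ -!mulrA.
Qed.

Lemma hall_sumZl (I : Type) (r : seq I) (P : pred I) (a : I -> K)
    (F : I -> Lambda K) (g : Lambda K) :
  hall (\sum_(i <- r | P i) a i *: F i) g =
  \sum_(i <- r | P i) a i * hall (F i) g.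
Proof.
rewrite -big_filter -[RHS]big_filter; apply: etrans (hall_suml _ _ _) _.
by apply: eq_bigr => i _; exact: hallZl.
Qed.

Lemma parts1 : parts 1 = [:: [:: 1%N]].
Proof.
apply: perm_small_eq => //; apply: uniq_perm => // [|mu]; first exact: parts_uniq.
rewrite mem_parts inE; apply/idP/eqP => [|-> //].
case: mu => [|[|[|x]] [|[|y] mu]] //=; rewrite /is_part ?inE ?andbF //=.
Qed.

(** Turns the normalization of H_(1) into <H_(1), p_1> = 1, the base case of the induction. *)
Lemma schur1 : schur K [:: 1%N] = psum K 1.
Proof.
rewrite /schur det_mx11 mxE /= /complete parts1 big_seq1.
have -> : pmon [:: 1%N] = ucm 0%N by rewrite /pmon big_seq1.
suff -> : zee K (ucm 0%N) = 1 by rewrite invr1.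
rewrite (@zeeEw _ [fset 0%N]%fset) ?mdomU ?fsubset_refl // big_seq_fset1.
by rewrite cmU eqxx.
Qed.

Variables (H : seq nat -> Lambda K) (c : seq nat -> seq nat -> K).
Hypotheses (HH : modified_macdonald q t H) (Hc : skew_pieri H c).

(** Stated for any list [e] of exponents, since the induction removes an arbitrary entry, the
    exponent of the first removed cell. *)
Lemma sum_Fcoef_permutations k (e : seq int) mu :
  size e = k -> mu \in parts k.+1 ->
  \sum_(al <- permutations e) Fcoef q t c al mu =
  monomial_sum e (alphabet_B1 q t mu) * hall (H mu) (psum K 1 ^+ k.+1).
Proof.
elim: k e mu => [|k IH] e mu se.
  rewrite parts1 inE => /eqP ->; rewrite (size0nil se).
  rewrite /monomial_sum (_ : permutations _ = [:: [::]]) // !big_seq1 big_ord0 mul1r expr1 -schur1 /=.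
  by have := macdonald_norm HH (isT : is_part [:: 1%N]) => /= ->.
rewrite mem_parts => /andP[pmu /eqP smu].
have e0 : (0 < size e)%N by rewrite se.
rewrite exprS -hall_e1perp Hc ?smu //= hall_sumZl mulr_sumr.
rewrite (perm_big _ (perm_permutations_rem e0)) /= big_allpairs_dep /= smu /=.
(* Moving the sum over [nu] outermost lets each term be matched with the term of [nu] in the skew
   Pieri expansion of e_1^perp H_mu. *)
under eq_bigr do rewrite exchange_big /=.
rewrite exchange_big big_seq_cond [RHS]big_seq_cond.
apply: eq_bigr => nu /andP[inu rnu].
have [pnu /eqP snu] := andP (etrans (esym (mem_parts _ _)) inu).
have al := removes_cell_alphabet pnu (etrans (congr1 _ snu) (ltn0Sn k)) rnu.
(* Listing the weight of the removed cell first lets [monomial_sum_cons] split off its exponent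
   [a]. *)
rewrite (monomial_sum_perm _ al); last first.
  by rewrite /= size_alphabet_B1 // snu.
rewrite monomial_sum_cons // mulr_suml !big_seq.
apply: eq_bigr => a; rewrite mem_undup => ia.
by rewrite -big_distrr /= IH ?size_rem ?se // (mulrC (c _ _)) mulrACA.
Qed.

Lemma sum_Fcoef_arrangements rho n mu : laurent_partition rho ->
  (0 < n)%N -> mu \in parts n ->
  \sum_(al <- arrangements n.-1 rho) Fcoef q t c al mu =
  mlaurent rho (alphabet_B1 q t mu) * hall (H mu) (psum K 1 ^+ n).
Proof.
case: n => // n Hrho _ imu.
have [pmu /eqP smu] := andP (etrans (esym (mem_parts _ _)) imu).
rewrite /mlaurent size_alphabet_B1 ?smu //=.
(* If [rho] is longer than the alphabet, no exponent vector sorts to it and both sides vanish. *)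
have [le|lt] := leqP (size rho) n; last first.
  by rewrite arrangements_small // !big_nil mul0r.
rewrite arrangements_permutations // (@sum_Fcoef_permutations n) //; last first.
  by rewrite size_cat size_nseq subnKC.
by rewrite /monomial_sum size_alphabet_B1 ?smu.
Qed.

End Macdonald.

Lemma q_neq0 : q_ != 0.
Proof. by rewrite tofrac_eq0 polyC_eq0 polyX_eq0. Qed.

Lemma t_neq0 : t_ != 0.
Proof. by rewrite tofrac_eq0 polyX_eq0. Qed.

Theorem theorem4p1
  (H : seq nat -> Lambda Qqt) (c : seq nat -> seq nat -> Qqt)
  (HH : modified_macdonald q_ t_ H) (Hc : skew_pieri H c)
  (rho : seq int) (Hrho : laurent_partition rho)
  (n : nat) (n_gt0 : (0 < n)%N)
  (Delta : {linear Lambda Qqt -> Lambda Qqt})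
  (HDelta : is_Delta' q_ t_ H n (mlaurent rho) Delta)
  (Hilb : seq int -> {scalar Lambda Qqt})
  (HHilb : forall alpha, size alpha = n.-1 ->
     is_Hilb_alpha q_ t_ H c n alpha (Hilb alpha))
  (f : Lambda Qqt) (Hf : f \in LambdaN n) :
  hall (Delta f) (psum Qqt 1 ^+ n) =
  \sum_(alpha <- arrangements n.-1 rho) Hilb alpha f.
Proof.
have [a ->] := macdonald_span HH Hf.
rewrite linear_sum hall_suml.
under [RHS]eq_bigr do rewrite linear_sum.
rewrite exchange_big [LHS]big_seq [RHS]big_seq; apply: eq_bigr => mu imu.
rewrite linearZ HDelta // !hallZl.
rewrite -(sum_Fcoef_arrangements q_neq0 t_neq0 HH Hc) // big_distrr !big_seq.
apply: eq_bigr => al; rewrite mem_arrangements => /andP[/eqP sal _].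
by rewrite linearZ HHilb.
Qed.
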